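(* Let $k_1,k_2>0$ with $\gamma:=k_1+k_2>1/2$, and let $H_k(y,z)$ be the density defined in the context. For any $y=(y_1,y_2)\in\mathbb{R}^2\setminus\{(0,0)\}$, the function $z\mapsto H_k(y,z)$ is supported in the convex hull $\mathrm{co}(y)$ of the orbit $Wy$, where $W$ is the group of signed permutation matrices of size 2 acting on $\mathbb{R}^2$, and this convex hull is given by $$\mathrm{co}(y)=\big\{z=(z_1,z_2)\in\mathbb{R}^2:\ |z_1|+|z_2|\le|y_1|+|y_2|,\ \max(|z_1|,|z_2|)\le\max(|y_1|,|y_2|)\big\}.$$
   Context: $W=(\mathbb{Z}_2)^2\rtimes S_2$ is the group of order 8 generated by the reflections of the root system $\{\pm e_1,\pm e_2,\pm e_1\pm e_2\}$ of type $B_2$ (all sign changes and permutations of the two coordinates). For $k_1,k_2>0$, $\gamma=k_1+k_2$, $y=(y_1,y_2)$, $z=(z_1,z_2)$, put $$H_k(y,z):=\frac{(2\gamma-1)c_k}{\pi}\int_{E_{y,z}}\Big((y_1^2-y_2^2)^2(1-u^2)+4y_1^2y_2^2(1-v^2)\Big)^{-\gamma+1}\Big\{(y_1^2+y_2^2-(z_1^2+z_2^2))^2-(z_1^2-z_2^2-u(y_1^2-y_2^2))^2-4(z_1z_2-vy_1y_2)^2\Big\}^{\gamma-3/2}(1-u^2)^{k_1-1}(1-v^2)^{k_2-1}\,du\,dv,$$ where $$E_{y,z}:=\Big\{(u,v)\in[-1,1]^2:\ (z_1^2-z_2^2-u(y_1^2-y_2^2))^2+4(z_1z_2-vy_1y_2)^2\le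 (y_1^2+y_2^2-(z_1^2+z_2^2))^2\Big\}$$ and $c_k=\frac{\Gamma(k_1+1/2)\Gamma(k_2+1/2)}{\pi\,\Gamma(k_1)\Gamma(k_2)}$. An integral over a (Lebesgue) null set, in particular over the empty set, is $0$. *)

(* Defs.v *)
From HB Require Import structures.
From mathcomp Require Import all_boot all_order all_algebra all_fingroup.
From mathcomp Require Import all_classical all_reals all_analysis.

Set Implicit Arguments.
Unset Strict Implicit.
Unset Printing Implicit Defensive.

Import Order.TTheory GRing.Theory Num.Theory.
Import numFieldNormedType.Exports.

Local Open Scope classical_set_scope.
Local Open Scope ring_scope.

(** Points of the plane are column vectors ['cV[R]_2], with coordinates
    [y 0 0] and [y 1 0]; matrices act on them by left multiplication. *)

Definition weylB2 (R : realType) : set 'M[R]_2 :=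
  [set w | exists (e : 'I_2 -> bool) (s : 'S_2),
     w = diag_mx (\row_i (-1) ^+ e i) *m perm_mx s].

Definition weyl_orbit (R : realType) (y : 'cV[R]_2) : set 'cV[R]_2 :=
  [set w *m y | w in @weylB2 R].

Definition convex_hull (R : realType) (M : lmodType R) (A : set M) : set M :=
  smallest (@convex_set R M) A.

Definition co (R : realType) (y : 'cV[R]_2) : set 'cV[R]_2 :=
  convex_hull (weyl_orbit y).

Definition Gamma_fun (R : realType) (a : R) : R :=
  \int[lebesgue_measure]_(t in `]0, +oo[) (t `^ (a - 1) * expR (- t)).

Definition c_const (R : realType) (k1 k2 : R) : R :=
  (Gamma_fun (k1 + 2^-1) * Gamma_fun (k2 + 2^-1)) /
  (pi * Gamma_fun k1 * Gamma_fun k2).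

Definition E_set (R : realType) (y z : 'cV[R]_2) : set (R * R) :=
  let y1 := y 0 0 in let y2 := y 1 0 in
  let z1 := z 0 0 in let z2 := z 1 0 in
  [set p | let u := p.1 in let v := p.2 in
     [/\ -1 <= u <= 1, -1 <= v <= 1 &
         (z1 ^+ 2 - z2 ^+ 2 - u * (y1 ^+ 2 - y2 ^+ 2)) ^+ 2
           + 4 * (z1 * z2 - v * y1 * y2) ^+ 2
         <= (y1 ^+ 2 + y2 ^+ 2 - (z1 ^+ 2 + z2 ^+ 2)) ^+ 2]].

(** For [(u, v)] in [E_set y z] all the bases of the real powers are
    nonnegative.  The library sets [0 `^ a = 0] for [a < 0]; when [y != 0] a
    base vanishes only on a Lebesgue-null set of [(u, v)], so this convention
    does not affect the integral. *)
Definition H_integrand (R : realType) (k1 k2 : R) (y z : 'cV[R]_2)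
    (u v : R) : R :=
  let g := k1 + k2 in
  let y1 := y 0 0 in let y2 := y 1 0 in
  let z1 := z 0 0 in let z2 := z 1 0 in
  ((y1 ^+ 2 - y2 ^+ 2) ^+ 2 * (1 - u ^+ 2)
     + 4 * y1 ^+ 2 * y2 ^+ 2 * (1 - v ^+ 2)) `^ (- g + 1)
  * ((y1 ^+ 2 + y2 ^+ 2 - (z1 ^+ 2 + z2 ^+ 2)) ^+ 2
     - (z1 ^+ 2 - z2 ^+ 2 - u * (y1 ^+ 2 - y2 ^+ 2)) ^+ 2
     - 4 * (z1 * z2 - v * y1 * y2) ^+ 2) `^ (g - 3 / 2)
  * (1 - u ^+ 2) `^ (k1 - 1) * (1 - v ^+ 2) `^ (k2 - 1).

(** The values are extended reals, so that a divergent integral gives [+oo],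
    which counts as nonzero when the support is taken. *)
Definition H (R : realType) (k1 k2 : R) (y z : 'cV[R]_2) : \bar R :=
  (((2 * (k1 + k2) - 1) * c_const k1 k2 / pi)%:E *
   \int[(lebesgue_measure \x lebesgue_measure)%E]_(p in E_set y z)
      (H_integrand k1 k2 y z p.1 p.2)%:E)%E.

Definition esupport (R : realType) (T : topologicalType) (f : T -> \bar R) :
  set T := closure [set x | f x != 0%E].

(* Main.v *)
(** Put [a = y1^2 - y2^2], [b = 2 y1 y2], [r = |y|^2], and [p], [q], [s]
    likewise for [z].  Then [a^2 + b^2 = r^2], [p^2 + q^2 = s^2], and [E_{y,z}]
    is the set of [(u, v)] in [[-1,1]^2] with [(ua, vb)] at distance at most
    [|r - s|] from [(p, q)].  If [s < r] and [E_{y,z}] is nonempty, the triangle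
    inequality in each coordinate gives [s + |q| <= r + |b|] and
    [s + |p| <= r + |a|]; these are the two inequalities of the octagon, since
    [(|y1| + |y2|)^2 = r + |b|] and [2 max(|y1|,|y2|)^2 = r + |a|].  If
    [r <= s], the point [(ua, vb)] of norm at most [r] has to lie on the circle
    of radius [r], so [u = 1] or [u = -1] when [a <> 0], and likewise for [v]
    when [b <> 0]: [E_{y,z}] is null. *)

Require Import Defs.
From HB Require Import structures.
From mathcomp Require Import all_boot all_order all_algebra all_fingroup.
From mathcomp Require Import all_classical all_reals all_analysis.
From mathcomp Require Import measurable_realfun ring lra.

Set Implicit Arguments.
Unset Strict Implicit.
Unset Printing Implicit Defensive.

Import Order.TTheory GRing.Theory Num.Theory.
Import numFieldNormedType.Exports.
Local Open Scope classical_set_scope.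
Local Open Scope ring_scope.

(** * Geometry of [E_set]: the disc and the ellipse *)

(* Cauchy-Schwarz, with [d := r^2 - (U^2 + V^2)]:
   [(s r - d / 2)^2 <= s^2 (r^2 - d)] forces [d = 0]. *)
Lemma tangent_disc_norm (R : realFieldType) (r s p q U V : R) :
  0 <= r -> r <= s -> p ^+ 2 + q ^+ 2 = s ^+ 2 ->
  U ^+ 2 + V ^+ 2 <= r ^+ 2 ->
  (p - U) ^+ 2 + (q - V) ^+ 2 <= (r - s) ^+ 2 ->
  U ^+ 2 + V ^+ 2 = r ^+ 2.
Proof.
move=> r0 rs pq UV h.
pose d := r ^+ 2 - (U ^+ 2 + V ^+ 2).
have d0 : 0 <= d by rewrite /d; lra.
have CS : (p * U + q * V) ^+ 2 <= s ^+ 2 * (r ^+ 2 - d).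
  have -> : s ^+ 2 * (r ^+ 2 - d) = (p * U + q * V) ^+ 2 + (p * V - q * U) ^+ 2.
    by rewrite -pq /d; ring.
  by rewrite lerDl sqr_ge0.
have rr : r ^+ 2 <= s * r by rewrite expr2 ler_wpM2r.
have c0 : 0 <= s * r - d / 2.
  by have := sqr_ge0 U; have := sqr_ge0 V; rewrite /d; nra.
have c1 : s * r - d / 2 <= p * U + q * V.
  have : (p - U) ^+ 2 + (q - V) ^+ 2
    = s ^+ 2 + (r ^+ 2 - d) - 2 * (p * U + q * V) by rewrite -pq /d; ring.
  by lra.
have c2 : (s * r - d / 2) ^+ 2 <= s ^+ 2 * (r ^+ 2 - d).
  by apply: le_trans CS; rewrite ler_sqr ?nnegrE// (le_trans c0).
have : d ^+ 2 <= 0.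
  (* The two sides of [c2] differ by [d * (s * (s - r)) + d ^+ 2 / 4], a sum of nonnegative
     terms. *)
  have e0 : 0 <= d * (s * (s - r)) by rewrite !mulr_ge0// ?subr_ge0//; lra.
  have : (s * r - d / 2) ^+ 2 - s ^+ 2 * (r ^+ 2 - d)
    = d * (s * (s - r)) + d ^+ 2 / 4 by field.
  by lra.
rewrite real_exprn_even_le0 ?num_real//= => /eqP; rewrite /d; lra.
Qed.

Lemma normr_le_sqr_sum (R : realDomainType) (x y m : R) :
  0 <= m -> x ^+ 2 + y ^+ 2 <= m ^+ 2 -> `|x| <= m.
Proof.
move=> m0 h; rewrite -ler_sqr ?nnegrE// real_normK ?num_real//.
by apply: le_trans h; rewrite lerDl sqr_ge0.
Qed.

Definition octagon {R : realType} (y : 'cV[R]_2) : set 'cV[R]_2 :=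
  [set z : 'cV[R]_2 |
    `|z 0 0| + `|z 1 0| <= `|y 0 0| + `|y 1 0| /\
    Num.max `|z 0 0| `|z 1 0| <= Num.max `|y 0 0| `|y 1 0|].

Definition sqnorm {R : realType} (y : 'cV[R]_2) : R :=
  y 0 0 ^+ 2 + y 1 0 ^+ 2.

Lemma normr_mul_le (R : realDomainType) (x u : R) :
  -1 <= u <= 1 -> `|u * x| <= `|x|.
Proof. by move=> hu; rewrite normrM ler_piMl// ler_norml. Qed.

Lemma sqr_max_norm (R : realFieldType) (x y : R) :
  2 * Num.max `|x| `|y| ^+ 2 = x ^+ 2 + y ^+ 2 + `|x ^+ 2 - y ^+ 2|.
Proof.
rewrite -[x ^+ 2]real_normK ?num_real// -[y ^+ 2]real_normK ?num_real//.
have [xy|yx] := leP `|x| `|y|.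
  by rewrite [`|_ - _|]ler0_norm ?subr_le0 ?ler_sqr ?nnegrE//; ring.
by rewrite [`|_ - _|]ger0_norm ?subr_ge0 ?ler_sqr ?nnegrE// ?(ltW yx)//; ring.
Qed.

Lemma sqr_sum_norm (R : realFieldType) (x y : R) :
  (`|x| + `|y|) ^+ 2 = x ^+ 2 + y ^+ 2 + `|2 * (x * y)|.
Proof.
rewrite -[x ^+ 2]real_normK ?num_real// -[y ^+ 2]real_normK ?num_real//.
by rewrite !normrM [`|2%:R|]ger0_norm ?ler0n//; ring.
Qed.

Lemma E_set_octagon (R : realType) (y z : 'cV[R]_2) (p : R * R) :
  sqnorm z < sqnorm y -> E_set y z p -> octagon y z.
Proof.
rewrite /sqnorm => sr [hu hv h].
set u := p.1 in hu h; set v := p.2 in hv h.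
set y1 := y 0 0 in sr h *; set y2 := y 1 0 in sr h *.
set z1 := z 0 0 in sr h *; set z2 := z 1 0 in sr h *.
have m0 : 0 <= y1 ^+ 2 + y2 ^+ 2 - (z1 ^+ 2 + z2 ^+ 2) by rewrite subr_ge0 ltW.
have hp : `|2 * (z1 * z2) - v * (2 * (y1 * y2))|
    <= y1 ^+ 2 + y2 ^+ 2 - (z1 ^+ 2 + z2 ^+ 2).
  apply: (@normr_le_sqr_sum _ _ (z1 ^+ 2 - z2 ^+ 2 - u * (y1 ^+ 2 - y2 ^+ 2))) => //.
  by apply: le_trans h; rewrite le_eqVlt; apply/orP; left; apply/eqP; ring.
have hq : `|z1 ^+ 2 - z2 ^+ 2 - u * (y1 ^+ 2 - y2 ^+ 2)|
    <= y1 ^+ 2 + y2 ^+ 2 - (z1 ^+ 2 + z2 ^+ 2).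
  apply: (@normr_le_sqr_sum _ _ (2 * (z1 * z2) - v * (2 * (y1 * y2)))) => //.
  by apply: le_trans h; rewrite le_eqVlt; apply/orP; left; apply/eqP; ring.
rewrite /octagon /= -/y1 -/y2 -/z1 -/z2; split.
  (* Squaring makes both octagon inequalities linear in absolute values; they follow from [hp] and
     [hq] by the triangle inequality. *)
  rewrite -ler_sqr ?nnegrE ?addr_ge0// !sqr_sum_norm.
  have := normr_mul_le (2 * (y1 * y2)) hv.
  have := ler_normD (2 * (z1 * z2) - v * (2 * (y1 * y2))) (v * (2 * (y1 * y2))).
  by rewrite subrK; lra.
rewrite -ler_sqr ?nnegrE ?le_max ?normr_ge0// -(ler_pM2l (ltr0n _ 2)) !sqr_max_norm.
have := normr_mul_le (y1 ^+ 2 - y2 ^+ 2) hu.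
have := ler_normD (z1 ^+ 2 - z2 ^+ 2 - u * (y1 ^+ 2 - y2 ^+ 2))
  (u * (y1 ^+ 2 - y2 ^+ 2)).
by rewrite subrK; lra.
Qed.

(** By [tangent_disc_norm], [(u a, v b)] has norm [r]. Since [a^2 + b^2 = r^2], the nonnegative
    terms [a^2 (1 - u^2)] and [b^2 (1 - v^2)] sum to zero. *)
Lemma E_set_rim (R : realType) (y z : 'cV[R]_2) (p : R * R) :
  sqnorm y <= sqnorm z -> E_set y z p ->
  (y 0 0 ^+ 2 - y 1 0 ^+ 2) ^+ 2 * (1 - p.1 ^+ 2) = 0 /\
  (2 * (y 0 0 * y 1 0)) ^+ 2 * (1 - p.2 ^+ 2) = 0.
Proof.
rewrite /sqnorm => rs [hu hv h].
set u := p.1 in hu h *; set v := p.2 in hv h *.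
set y1 := y 0 0 in rs h *; set y2 := y 1 0 in rs h *.
set z1 := z 0 0 in rs h; set z2 := z 1 0 in rs h.
have u0 : 0 <= (y1 ^+ 2 - y2 ^+ 2) ^+ 2 * (1 - u ^+ 2).
  by rewrite mulr_ge0 ?sqr_ge0//; case/andP: hu; nra.
have v0 : 0 <= (2 * (y1 * y2)) ^+ 2 * (1 - v ^+ 2).
  by rewrite mulr_ge0 ?sqr_ge0//; case/andP: hv; nra.
have e : (u * (y1 ^+ 2 - y2 ^+ 2)) ^+ 2 + (v * (2 * (y1 * y2))) ^+ 2
  = (y1 ^+ 2 + y2 ^+ 2) ^+ 2 - (y1 ^+ 2 - y2 ^+ 2) ^+ 2 * (1 - u ^+ 2)
    - (2 * (y1 * y2)) ^+ 2 * (1 - v ^+ 2) by ring.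
have : (u * (y1 ^+ 2 - y2 ^+ 2)) ^+ 2 + (v * (2 * (y1 * y2))) ^+ 2
    = (y1 ^+ 2 + y2 ^+ 2) ^+ 2.
  apply: (@tangent_disc_norm _ _ (z1 ^+ 2 + z2 ^+ 2)
    (z1 ^+ 2 - z2 ^+ 2) (2 * (z1 * z2))) => //.
  - by rewrite addr_ge0 ?sqr_ge0.
  - by ring.
  - by rewrite e; lra.
  - by apply: le_trans h; rewrite le_eqVlt; apply/orP; left; apply/eqP; ring.
by rewrite e => e'; split; lra.
Qed.

(** * Null sets, and the vanishing of [H] off the octagon *)

Import HBNNSimple.

(* Neither [D] nor [f] has to be measurable: every simple function below [f]
   on [D] vanishes outside [N]. *)
Lemma integral_null_subset d (T : measurableType d) (R : realType)
    (mu : {measure set T -> \bar R}) (D N : set T) (f : T -> \bar R) :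
  measurable N -> mu N = 0%E -> D `<=` N -> (\int[mu]_(x in D) f x = 0)%E.
Proof.
move=> mN N0 DN.
have ge0_int g : (forall x, 0 <= g x)%E -> (forall x, ~ N x -> g x = 0%E) ->
    (\int[mu]_x g x = 0)%E.
  move=> g0 gN; apply/eqP; rewrite eq_le integral_ge0// andbT ge0_integralTE//.
  apply: ge_ereal_sup => _ [h hg <-].
  (* Off [N], [h] lies between [0] and [g = 0], so it equals its restriction to [N]. *)
  rewrite -integralT_nnsfun (_ : (fun x => (h x)%:E) = (EFin \o h) \_ N).
    rewrite -integral_mkcond null_set_integral//.
    by apply/measurable_EFinP; exact: measurable_funTS.
  apply/funext => x; rewrite patchE; case: ifPn => // /negP xN.
  apply/le_anti/andP; split; last by rewrite lee_fin fun_ge0.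
  by rewrite (le_trans (hg x))// gN// => /mem_set.
rewrite integral_mkcond integralE !ge0_int ?sube0// => x xN.
- by rewrite funenegE patchE memNset ?oppe0 ?maxxx// => /DN.
- by rewrite funeposE patchE memNset ?maxxx// => /DN.
Qed.

(** [N] is a pair of parallel lines, the product of [{1, -1}] with a full line; its measure is a
    product with a zero factor. *)
Lemma unit_coord_measurable_null (R : realType) (c : bool) :
  let N := [set p : measurableTypeR R * measurableTypeR R |
    (if c then p.1 else p.2) ^+ 2 = 1] in
  measurable N /\ (lebesgue_measure \x lebesgue_measure)%E N = 0%E.
Proof.
move=> N; pose S : set (measurableTypeR R) := [set 1] `|` [set -1].
have mS : measurable S by exact: measurableU.
have S0 : lebesgue_measure S = 0%E :> \bar R.
  apply/eqP; rewrite -measure_le0 -[leRHS](adde0 0%E).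
  rewrite -[X in (_ <= X + _)%E](lebesgue_measure_set1 (1 : R)).
  by rewrite -[X in (_ <= _ + X)%E](lebesgue_measure_set1 (-1 : R)) measureU2.
have SE x : (x ^+ 2 = 1) = S x.
  by apply/propext; split => [/eqP|]; [rewrite sqrf_eq1 => /orP[]/eqP; [left|right]|
    move=> [] ->; rewrite ?sqrrN expr1n].
have NE : N = if c then S `*` setT else setT `*` S.
  by apply/seteqP; rewrite /N; case: (c); split => -[u v] /=; rewrite SE; tauto.
rewrite NE; case: (c); split; try exact: measurableX.
  by rewrite product_measure1E// [X in (X * _)%E]S0 mul0e.
by rewrite product_measure1E// [X in (_ * X)%E]S0 mule0.
Qed.

Lemma ord2P (i : 'I_2) : i = 0 \/ i = 1.
Proof. by case: i => -[|[|]]// hi; [left|right]; apply/val_inj. Qed.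

Lemma H_eq0 (R : realType) (k1 k2 : R) (y z : 'cV[R]_2) :
  y != 0 -> ~ octagon y z -> H k1 k2 y z = 0%E.
Proof.
move=> y0 zy; rewrite /H; apply/eqP; rewrite mule_eq0; apply/orP; right.
apply/eqP; have [yz|zy'] := leP (sqnorm y) (sqnorm z); last first.
  rewrite (_ : E_set y z = set0) ?integral_set0//.
  by rewrite -subset0 => p /(E_set_octagon zy').
have [a0|a0] := eqVneq (y 0 0 ^+ 2 - y 1 0 ^+ 2) 0.
(* [a^2 + b^2 = r^2], so [a] and [b] cannot both vanish when [y != 0]. *)
- have b0 : 2 * (y 0 0 * y 1 0) != 0.
    apply: contra_neq y0 => b0; apply/matrixP => i j; rewrite ord1 mxE.
    have : (y 0 0 ^+ 2 + y 1 0 ^+ 2) ^+ 2 = 0.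
      rewrite (_ : _ ^+ 2 = (y 0 0 ^+ 2 - y 1 0 ^+ 2) ^+ 2
        + (2 * (y 0 0 * y 1 0)) ^+ 2); last by ring.
      by rewrite a0 b0 expr0n addr0.
    move/eqP; rewrite sqrf_eq0 paddr_eq0 ?sqr_ge0// !sqrf_eq0 => /andP[/eqP h0 /eqP h1].
    by case: (ord2P i) => ->.
  have [mN N0] := unit_coord_measurable_null R false.
  apply: (integral_null_subset _ mN N0) => p /(E_set_rim yz)[_ /eqP].
  by rewrite mulf_eq0 sqrf_eq0 (negPf b0)/= subr_eq0 => /eqP.
- have [mN N0] := unit_coord_measurable_null R true.
  apply: (integral_null_subset _ mN N0) => p /(E_set_rim yz)[/eqP + _].
  by rewrite mulf_eq0 sqrf_eq0 (negPf a0)/= subr_eq0 => /eqP.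
Qed.

(** The support is a closure, so [H_eq0] bounds it only together with this fact. *)
Lemma octagon_closed (R : realType) (y : 'cV[R]_2) : closed (octagon y).
Proof.
have nc i : continuous (fun z : 'cV[R]_2 => `|z i 0|).
  by move=> z; apply: continuous_comp; [exact: coord_continuous|exact: norm_continuous].
apply: (@closedI _
    ((fun z : 'cV[R]_2 => `|z 0 0| + `|z 1 0|) @^-1` [set x | x <= _])
    ((fun z : 'cV[R]_2 => Num.max `|z 0 0| `|z 1 0|) @^-1` [set x | x <= _]));
  apply: (preimage_closed _ (@closed_le R _)) => z _.
  by apply: (@continuousD _ _ _ (fun z : 'cV[R]_2 => `|z 0 0|)
    (fun z : 'cV[R]_2 => `|z 1 0|)); exact: nc.
by apply: (@continuous_max _ _ (fun z : 'cV[R]_2 => `|z 0 0|)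
  (fun z : 'cV[R]_2 => `|z 1 0|)); exact: nc.
Qed.

(** * The orbit and its convex hull *)

Lemma weyl_orbitP (R : realType) (y z : 'cV[R]_2) :
  weyl_orbit y z <-> exists (e : 'I_2 -> bool) (s : 'S_2),
    forall i, z i 0 = (-1) ^+ e i * y (s i) 0.
Proof.
have wyE (e : 'I_2 -> bool) (s : 'S_2) i :
    (diag_mx (\row_i (-1) ^+ e i) *m perm_mx s *m y) i 0
    = (-1) ^+ e i * y (s i) 0.
  by rewrite -mulmxA -row_permE mul_diag_mx !mxE.
split => [[_ [e [s ->]] <-]|[e [s zE]]].
  by exists e, s => i; rewrite wyE.
exists (diag_mx (\row_i (-1) ^+ e i) *m perm_mx s); first by exists e, s.
by apply/matrixP => i j; rewrite ord1 wyE zE.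
Qed.

Definition point {R : realType} (a b : R) : 'cV[R]_2 :=
  \col_(i < 2) if i == 0 then a else b.

Lemma pointE (R : realType) (z : 'cV[R]_2) : z = point (z 0 0) (z 1 0).
Proof.
by apply/matrixP => i j; rewrite ord1 mxE; case: (ord2P i) => ->.
Qed.

Lemma conv_lmodE (R : numDomainType) (M : lmodType R) (a b : convex_lmodType M)
    (l : {i01 R}) :
  conv l a b = l%:num *: (a : M) + (1 - l%:num) *: (b : M).
Proof. by []. Qed.

Lemma octagon_convex (R : realType) (y : 'cV[R]_2) :
  @convex_set R 'cV[R]_2 (octagon y).
Proof.
move=> a b l; rewrite !inE => -[a1 a2] [b1 b2].
have l0 : 0 <= l%:num by [].
have l1 : 0 <= 1 - l%:num by rewrite subr_ge0.
have ab i : `|(conv l a b : 'cV[R]_2) i 0|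
    <= l%:num * `|a i 0| + (1 - l%:num) * `|b i 0|.
  rewrite conv_lmodE !mxE (le_trans (ler_normD _ _))// !normrM.
  by rewrite (ger0_norm l0) (ger0_norm l1).
have := ab 0; have := ab 1; rewrite /octagon /=.
split; first by nra.
move: a2 b2; rewrite !ge_max => /andP[? ?] /andP[? ?].
by apply/andP; split; nra.
Qed.

Lemma weyl_orbit_octagon (R : realType) (y : 'cV[R]_2) :
  weyl_orbit y `<=` octagon y.
Proof.
move=> z /weyl_orbitP[e [s zE]].
have nz i : `|z i 0| = `|y (s i) 0| by rewrite zE normrMsign.
rewrite /octagon /= !nz.
(* Injectivity leaves only the identity and the swap. *)
have : s 1 != s 0 by rewrite (inj_eq perm_inj).
by case: (ord2P (s 0)) (ord2P (s 1)) => -> [] -> // _; rewrite addrC maxC.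
Qed.

(** These are the vertices of the octagon: [d] swaps the coordinates, [b] and [c] choose the
    signs. *)
Lemma normr_signed_orbit (R : realType) (y : 'cV[R]_2) (b c d : bool) :
  weyl_orbit y (point ((-1) ^+ b * `|y (if d then 1 else 0) 0|)
                      ((-1) ^+ c * `|y (if d then 0 else 1) 0|)).
Proof.
apply/weyl_orbitP.
pose s : 'S_2 := if d then tperm 0 1 else 1%g.
have s0 : s 0 = if d then 1 else 0 by rewrite /s; case: (d); rewrite ?tpermL ?perm1.
have s1 : s 1 = if d then 0 else 1 by rewrite /s; case: (d); rewrite ?tpermR ?perm1.
(* The extra sign turns [y (s i) 0] into its absolute value. *)
exists (fun i => (if i == 0 then b else c) (+) (y (s i) 0 < 0)), s => i.
rewrite mxE signr_addb -mulrA -normrEsign.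
by case: (ord2P i) => -> /=; rewrite ?s0 ?s1.
Qed.

(** Taking the weight as a plain real leaves coordinate equations that [ring] and [field] can
    settle. *)
Lemma convex_set_segment (R : realType) (C : set 'cV[R]_2) (l a a' b b' c d : R) :
  @convex_set R 'cV[R]_2 C -> C (point a b) -> C (point a' b') ->
  0 <= l <= 1 -> c = l * a + (1 - l) * a' -> d = l * b + (1 - l) * b' ->
  C (point c d).
Proof.
move=> cC Cab Cab' l01 cE dE.
have hl : Itv.spec (@Itv.num_sem R) (Itv.Real `[0%Z, 1%Z]) l.
  by apply/and3P; split; rewrite ?num_real//= ?bnd_simp; case/andP: l01.
have := cC (point a b) (point a' b') (Itv.mk hl).
rewrite !inE => /(_ Cab Cab'); congr C.
rewrite conv_lmodE; apply/matrixP => i j; rewrite !mxE /=.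
by case: ifP.
Qed.

Lemma convex_set_vertical (R : realType) (C : set 'cV[R]_2) (a b1 b2 b : R) :
  @convex_set R 'cV[R]_2 C -> C (point a b1) -> C (point a b2) ->
  b1 <= b <= b2 -> C (point a b).
Proof.
move=> cC C1 C2 /andP[h1 h2].
have [e|ne] := eqVneq b1 b2.
  by have -> : b = b1 by lra.
have lt12 : 0 < b2 - b1 by rewrite subr_gt0 lt_neqAle ne (le_trans h1).
have ne0 := lt0r_neq0 lt12.
apply: (@convex_set_segment _ _ ((b2 - b) / (b2 - b1)) _ _ _ _ _ _ cC C1 C2).
- by rewrite divr_ge0 ?ler_pdivrMr//=; lra.
- by ring.
- by field.
Qed.

(* The vertical line through [z] meets the octagon in a segment whose ends lie
   on horizontal edges if [|z1| <= m], and on slanted edges otherwise. *)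
Lemma octagon_sub_convex (R : realType) (C : set 'cV[R]_2) (M m z1 z2 : R) :
  @convex_set R 'cV[R]_2 C ->
  (forall b c : bool, C (point ((-1) ^+ b * M) ((-1) ^+ c * m))) ->
  (forall b c : bool, C (point ((-1) ^+ b * m) ((-1) ^+ c * M))) ->
  0 <= m <= M -> `|z1| + `|z2| <= M + m -> Num.max `|z1| `|z2| <= M ->
  C (point z1 z2).
Proof.
move=> cC CM Cm /andP[m0 mM] hs; rewrite ge_max => /andP[h1 h2].
have [z1m|mz1] := leP `|z1| m.
  have hor (c : bool) : C (point z1 ((-1) ^+ c * M)).
    (* For [m = 0] the horizontal edge shrinks to the vertex [(0, M)] or [(0, -M)]. *)
    have [m00|mp] := eqVneq m 0.
      have -> : z1 = (-1) ^+ false * m.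
        by move: z1m; rewrite m00 normr_le0 => /eqP ->; rewrite mulr0.
      exact: Cm.
    have {}mp : 0 < m by rewrite lt_neqAle eq_sym mp.
    move: z1m; rewrite ler_norml => /andP[? ?].
    apply: (@convex_set_segment _ _ ((m + z1) / (2 * m)) _ _ _ _ _ _ cC
      (Cm false c) (Cm true c)).
    - by rewrite divr_ge0 ?ler_pdivrMr//=; lra.
    - by rewrite expr0 expr1; field; rewrite lt0r_neq0.
    - by ring.
  apply: (convex_set_vertical cC (hor true) (hor false)).
  by rewrite expr0 expr1 mul1r mulN1r -ler_norml.
pose b := z1 < 0.
have z1E : z1 = (-1) ^+ b * `|z1| by exact: numEsign.
(* The slanted edge joins [(M, m)] to [(m, M)] up to signs; the weight solves for first coordinate
   [z1]. Here [m < M] because [m < |z1| <= M]. *)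
have side (c : bool) : C (point z1 ((-1) ^+ c * (M + m - `|z1|))).
  have mM' : 0 < M - m by lra.
  apply: (@convex_set_segment _ _ ((`|z1| - m) / (M - m)) _ _ _ _ _ _ cC
    (CM b c) (Cm b c)).
  - by rewrite divr_ge0 ?ler_pdivrMr//=; lra.
  - by rewrite [LHS]z1E; field; rewrite lt0r_neq0.
  - by field; rewrite lt0r_neq0.
apply: (convex_set_vertical cC (side true) (side false)).
by rewrite expr0 expr1 mul1r mulN1r -ler_norml; lra.
Qed.

Lemma coE (R : realType) (y : 'cV[R]_2) : co y = octagon y.
Proof.
apply/seteqP; split.
  apply: smallest_sub; [exact: octagon_convex|exact: weyl_orbit_octagon].
move=> z [hs hm] C [cC yC]; rewrite (pointE z).
have Cy b c d := yC _ (normr_signed_orbit y b c d).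
(* The larger of the two absolute values plays the role of [M]. *)
have [yy|yy] := leP `|y 0 0| `|y 1 0|.
  apply: (@octagon_sub_convex _ C `|y 1 0| `|y 0 0|) => //.
  - by move=> b c; exact: (Cy b c true).
  - by move=> b c; exact: (Cy b c false).
  - by rewrite normr_ge0.
  - by rewrite [leRHS]addrC.
  - by rewrite (le_trans hm)// ge_max yy lexx.
apply: (@octagon_sub_convex _ C `|y 0 0| `|y 1 0|) => //.
- by move=> b c; exact: (Cy b c false).
- by move=> b c; exact: (Cy b c true).
- by rewrite normr_ge0 ltW.
- by rewrite (le_trans hm)// ge_max (ltW yy) lexx.
Qed.

Theorem proposition1 (R : realType) (k1 k2 : R) (hk1 : 0 < k1) (hk2 : 0 < k2)
    (hg : 2^-1 < k1 + k2) (y : 'cV[R]_2) (hy : y != 0) :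
  esupport (H k1 k2 y) `<=` co y /\
  co y = [set z : 'cV[R]_2 |
    `|z 0 0| + `|z 1 0| <= `|y 0 0| + `|y 1 0| /\
    Num.max `|z 0 0| `|z 1 0| <= Num.max `|y 0 0| `|y 1 0|].
Proof.
split; last exact: coE.
rewrite coE /esupport [X in _ `<=` X](closure_id _).1; last exact: octagon_closed.
apply: closure_subset => z /= Hz; apply: contrapT => zy.
by move: Hz; rewrite H_eq0// eqxx.
Qed.
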